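(* Let $G$ be a finite group in which every maximal subgroup is nilpotent or normal in $G$. Then for each prime divisor $q$ of $|G|$, $G$ is $q$-nilpotent or $q$-closed.
   Context: For a prime $q$, a finite group $G$ is $q$-nilpotent if it has a normal $q$-complement (a normal subgroup of order coprime to $q$ and index a power of $q$), and $q$-closed if its Sylow $q$-subgroup is normal in $G$. *)

(* Defs.v *)
From mathcomp Require Import all_boot all_fingroup all_solvable.
Set Implicit Arguments. Unset Strict Implicit. Unset Printing Implicit Defensive.
Local Open Scope group_scope.

Definition q_nilpotent (gT : finGroupType) (q : nat) (G : {group gT}) : Prop :=
  exists K : {group gT},
    [/\ K <| G, coprime #|K| q & exists n : nat, #|G : K| = (q ^ n)%N].

Definition q_closed (gT : finGroupType) (q : nat) (G : {group gT}) : Prop :=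
  exists2 P : {group gT}, P \in 'Syl_q(G) & P <| G.

(* Main.v *)
Require Import Defs.
From mathcomp Require Import all_boot all_fingroup ssralg all_solvable.
Set Implicit Arguments.
Unset Strict Implicit.
Unset Printing Implicit Defensive.
Import GroupScope FiniteModule.
Local Open Scope group_scope.

(** Call [G] p-nilpotent ([pnil p G]) if it has a normal p-complement.  The
    heart of the matter is Thompson's theorem: for p odd, if the normaliser of
    every nontrivial characteristic subgroup of a Sylow p-subgroup is
    p-nilpotent, then so is the whole group.

    It forces [G] to be solvable.  Otherwise, in a minimal counterexample, let
    N be a nonsolvable minimal normal subgroup, p an odd prime divisor of #|N|,
    P a Sylow p-subgroup of N and D a nontrivial characteristic subgroup of P.
    Since G = N * 'N_G(P) by the Frattini argument, a maximal subgroup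
    containing 'N_G(D) cannot be normal, so it is nilpotent; Thompson's theorem
    makes N p-nilpotent, which contradicts its minimality.

    For solvable [G] with nonnormal Sylow q-subgroup, factor out 'O_q^'(G) or
    'O_q(G) and apply the Frattini argument to a Hall q'-subgroup T of
    the preimage of 'O_q^'(G / 'O_q(G)): a maximal subgroup containing 'N_G(T)
    can be neither normal nor nilpotent, so T is normal in G. *)

(** * Groups with a normal p-complement *)

Definition pnil (p : nat) (gT : finGroupType) (G : {group gT}) :=
  p.-group (G / 'O_p^'(G)).

Section Pnil.
Variables (p : nat) (gT : finGroupType).
Implicit Types G H K P : {group gT}.

(** [K] lies in the p'-core, whose index therefore divides the p-number [#|G : K|]. Any normal
    p-complement can thus serve as a witness. *)
Lemma pnilI G K : K <| G -> p^'.-group K -> p.-group (G / K) -> pnil p G.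
Proof.
move=> nsKG p'K pGK; rewrite /pnil /pgroup card_quotient ?gFnorm //.
apply: pnat_dvd (indexgS G (pcore_max p'K nsKG)) _.
by rewrite -card_quotient ?normal_norm.
Qed.

Lemma pnilS G H : H \subset G -> pnil p G -> pnil p H.
Proof.
move=> sHG pnG; set K := 'O_p^'(G) in pnG.
have nKH: H \subset 'N(K) by apply: subset_trans sHG (gFnorm _ _).
apply: (@pnilI H ('O_p^'(G) :&: H)).
- by rewrite /normal subsetIr normsI ?normG.
- exact: pgroupS (subsetIl _ _) (pcore_pgroup _ _).
rewrite (isog_pgroup _ (second_isog nKH)).
by apply: pgroupS pnG; apply: quotientS.
Qed.

Lemma nilpotent_pnil G : nilpotent G -> pnil p G.
Proof.
move=> /(nilpotent_pcore_Hall p^')/and3P[_ _].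
by rewrite pnatNK /pnil /pgroup card_quotient ?gFnorm.
Qed.

Lemma pgroup_pnil G : p.-group G -> pnil p G.
Proof. by move/pgroup_nil/nilpotent_pnil. Qed.

Lemma pnil_pgroup G : pnil p G -> 'O_p^'(G) = 1 -> p.-group G.
Proof.
rewrite /pnil => pnG G1; move: pnG; rewrite G1.
by rewrite -(isog_pgroup _ (quotient1_isog G)).
Qed.

Lemma pnil_mulg G P : pnil p G -> p.-Sylow(G) P -> 'O_p^'(G) * P = G.
Proof.
move=> pnG sylP; apply/eqP; rewrite eqEcard mul_subG ?pcore_sub ?(pHall_sub sylP) //=.
have coKP: coprime #|'O_p^'(G)| #|P|.
  by rewrite coprime_sym; apply: pnat_coprime (pHall_pgroup sylP) (pcore_pgroup _ _).
rewrite coprime_cardMg // (card_Hall sylP) -(Lagrange (pcore_sub p^' G)) leq_pmul2l //.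
have pnGK: p.-nat #|G : 'O_p^'(G)| by rewrite -card_quotient ?gFnorm.
rewrite (Lagrange (pcore_sub p^' G)) dvdn_leq // -(part_pnat_id pnGK).
by rewrite partn_dvd ?dvdn_indexg.
Qed.

(** Two normal subgroups of coprime orders commute, since their commutator lies in their
    intersection. *)
Lemma pnil_p'pcore_cent G H :
  pnil p G -> p.-group H -> H <| G -> 'O_p^'(G) \subset 'C(H).
Proof.
move=> pnG pH nsHG; rewrite centsC; apply/commG1P/trivgP.
have coHK: coprime #|H| #|'O_p^'(G)| := pnat_coprime pH (pcore_pgroup _ _).
rewrite -(coprime_TIg coHK) subsetI commg_subl commg_subr.
have [sHG nHG] := andP nsHG.
by rewrite gFsub_trans // (subset_trans sHG (gFnorm _ _)).
Qed.
End Pnil.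

Lemma pnil_quotient (p : nat) (gT : finGroupType) (G N : {group gT}) :
  G \subset 'N(N) -> pnil p G -> pnil p (G / N).
Proof.
move=> nNG pnG; apply: (@pnilI _ _ (G / N) ('O_p^'(G) / N)).
- exact: quotient_normal (pcore_normal _ _).
- exact/quotient_pgroup/pcore_pgroup.
rewrite /pgroup card_quotient ?quotient_norms ?gFnorm //.
apply: pnat_dvd (index_quotient _) _; last by rewrite -card_quotient ?gFnorm.
by rewrite subIset ?nNG.
Qed.

(** * Frobenius' normal p-complement theorem *)

(* Descending induction on the intersection: if it is a proper nontrivial D,
   then 'N_G(D) is p-nilpotent and its p'-core centralises D. *)
Lemma Sylow_conj_cent (p : nat) (gT : finGroupType) (G P S : {group gT}) :
    (forall E : {group gT}, E \subset G -> p.-group E -> E :!=: 1 ->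
       pnil p 'N_G(E)) ->
    p.-Sylow(G) P -> p.-Sylow(G) S ->
  exists2 c, c \in 'C_G(P :&: S) & S :=: P :^ c.
Proof.
move=> locG; have [n] := ubnP (#|P| - #|P :&: S|).
elim: n => // n IHn in P S * => ltPS sylP sylS.
have [sPG pP _] := and3P sylP; have [sSG pS _] := and3P sylS.
have oPS: #|P| = #|S| by rewrite (card_Hall sylP) (card_Hall sylS).
pose D := (P :&: S)%G.
have sDP: D \subset P := subsetIl _ _; have sDS: D \subset S := subsetIr _ _.
have [D1 | ntD] := eqVneq (gval D) 1.
  have [x Gx defS] := Sylow_trans sylP sylS; exists x => //.
by rewrite (D1 : P :&: S = 1) cent1T setIT.
have [defD | neqDP] := eqVneq (gval D) P.
  exists 1; first exact: group1.
  by apply/eqP; rewrite conjsg1 eq_sym eqEcard oPS leqnn andbT -defD.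
have ltDP: D \proper P by rewrite properEneq neqDP.
have ltDS: D \proper S by rewrite properEcard sDS -oPS proper_card.
have ltDNP: D \proper 'N_P(D) := nilpotent_proper_norm (pgroup_nil pP) ltDP.
have ltDNS: D \proper 'N_S(D) := nilpotent_proper_norm (pgroup_nil pS) ltDS.
have pD: p.-group D := pgroupS sDP pP.
have sDG := subset_trans sDP sPG.
have pN: pnil p 'N_G(D) by apply: locG.
have [P1 sylP1 sNP1] := Sylow_superset (setSI 'N(D) sPG) (pgroupS (subsetIl _ _) pP).
have [S1 sylS1 sNS1] := Sylow_superset (setSI 'N(D) sSG) (pgroupS (subsetIl _ _) pS).
have [x Nx defS1] := Sylow_trans sylP1 sylS1.
have defN := pnil_mulg pN sylP1.
(* ['N_G(D)] is the product of [P1] and its p'-core, and the [P1]-factor of [x] does not move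
   [P1]. *)
have [c Oc defS1c]: exists2 c, c \in 'O_p^'('N_G(D)) & S1 :=: P1 :^ c.
  have: x \in P1 * 'O_p^'('N_G(D)).
    by rewrite normC ?defN // (subset_trans (pHall_sub sylP1)) ?gFnorm.
  by case/mulsgP=> u c P1u Oc defx; exists c; rewrite // defS1 defx conjsgM conjGid.
have nsDN: D <| 'N_G(D) by rewrite normal_subnorm.
have cDc: c \in 'C(D) := subsetP (pnil_p'pcore_cent pN pD nsDN) c Oc.
have Gc: c \in G by have /setIP[] := subsetP (pcore_sub _ _) c Oc.
have sP1G : P1 \subset G := subset_trans (pHall_sub sylP1) (subsetIl _ _).
have [P2 sylP2 sP12] := Sylow_superset sP1G (pHall_pgroup sylP1).
have lt_IH (T U : {group gT}) : #|T| = #|P| -> D \proper T :&: U -> #|T| - #|T :&: U| < n.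
  move=> oT ltD; apply: leq_trans (ltPS : _ <= n); rewrite oT.
  by apply: ltn_sub2l; [apply: proper_card | apply: (proper_card ltD)].
have sDPP2: 'N_P(D) \subset P :&: P2.
  by rewrite subsetI subsetIl (subset_trans sNP1).
(* [S] is reached from [P] through [P2] and [P2 :^ c]. The outer pairs meet in at least ['N_P(D)]
   and ['N_S(D)], both larger than [D], so induction applies to each and the conjugators centralise
   [D]. *)
have [|c1 /setIP[Gc1 cc1] defP2] := IHn P P2 _ sylP sylP2.
  by apply: lt_IH => //; apply: proper_sub_trans sDPP2.
have sylP2c: p.-Sylow(G) (P2 :^ c) by rewrite pHallJ.
have sDSP2: 'N_S(D) \subset (P2 :^ c) :&: S.
  by rewrite subsetI subsetIl andbT (subset_trans sNS1) // defS1c conjSg.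
have [|c2 /setIP[Gc2 cc2] defS] := IHn (P2 :^ c)%G S _ sylP2c sylS.
  apply: lt_IH; last by apply: proper_sub_trans sDSP2.
  by rewrite cardJg (card_Hall sylP) (card_Hall sylP2).
exists (c1 * c * c2); last by rewrite !conjsgM -defP2.
rewrite inE !groupM //.
  by apply: subsetP cc1; apply: centS; apply: subset_trans sDPP2; apply: proper_sub.
by apply: subsetP cc2; apply: centS; apply: subset_trans sDSP2; apply: proper_sub.
Qed.

(* The transfer into P / P^`(1) sends y in P to the #|G : P|-th power of the
   coset of y, hence is nontrivial. *)
Lemma control_fusion_normal (p : nat) (gT : finGroupType) (G P : {group gT}) :
    p.-Sylow(G) P -> P :!=: 1 ->
    (forall x g, x \in P -> g \in G -> x ^ g \in P ->
       exists2 u, u \in P & x ^ g = x ^ u) ->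
  exists K : {group gT}, [/\ K <| G, K \proper G & p.-group (G / K)].
Proof.
move=> sylP ntP fusP; have [sPG pP p'i] := and3P sylP.
pose alpha := restrm_morphism (der_norm 1 P) (coset_morphism P^`(1)).
have defA: alpha @* P = P / P^`(1) by rewrite morphim_restrm setIid.
have abA: abelian (alpha @* P) by rewrite defA der_abelian.
pose V := transfer_morphism G abA; exists ('ker V)%G.
have nsKG: 'ker V <| G by apply: ker_normal.
split=> //.
  rewrite properEneq normal_sub // andbT; apply: contraNneq ntP => defK.
  have: P :==: P^`(1).
    rewrite eqEsubset der_sub andbT; apply/subsetP=> y Py.
    have Gy := subsetP sPG y Py.
    have: V y = 1%g by apply: mker; rewrite defK.
    have trX := transversalP (rcosets_cycle_partition sPG Gy).
    rewrite /= (transfer_cycle_expansion sPG abA Gy trX).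
    set X := transversal _ _; pose cy := coset P^`(1) y.
    have nP'P := der_norm 1 P.
    have Acy: cy \in alpha @* P by rewrite defA mem_quotient.
    rewrite (eq_bigr (fun x => fmod abA cy *+ #|<[y]> : P :* x|)%R) => [|x Xx].
      rewrite GRing.sumrMnr (sum_index_rcosets_cycle sPG Gy trX).
      rewrite -fmodX // => cy1.
      have: cy ^+ #|G : P| = 1.
        by rewrite -(fmodK abA (groupX _ Acy)) cy1.
      (* The order of [cy] is a power of p and divides the p'-number [#|G : P|]. *)
      move=> cyn; have: cy \in [1].
        have: coprime #[cy] #|G : P|.
          apply: pnat_coprime p'i; apply: mem_p_elt (quotient_pgroup _ pP) _.
          exact: mem_quotient Py.
        have dv: #[cy] %| #|G : P| by rewrite order_dvdn cyn.
        by rewrite /coprime (gcdn_idPl dv) order_eq1 inE.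
      by move/set1P/coset_idr; apply; apply: (subsetP nP'P).
    have [_ sXG _] := and3P trX.
    set n := #|_ : _|.
    have Gx: x \in G by apply: (subsetP sXG).
    have Pz: (y ^+ n) ^ x^-1 \in P.
      have := mulg_exp_card_rcosets P y x.
      by rewrite mem_rcoset conjgE invgK mulgA.
    have [u Pu ->] := fusP _ _ (groupX n Py) (groupVr Gx) Pz.
    rewrite -fmodX //; congr (fmod abA _).
    have nPy: y \in 'N(P^`(1)) := subsetP nP'P y Py.
    have nPu: u \in 'N(P^`(1)) := subsetP nP'P u Pu.
    have cPP: abelian (P / P^`(1)) := der_abelian 0 P.
    rewrite /alpha /= /restrm morphJ ?groupX //= morphX //.
    rewrite /conjg -(centsP cPP (coset P^`(1) u)) ?mulKg ?groupX ?mem_quotient //.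
  apply: contraTT => /(sol_der1_proper (pgroup_sol pP) (subxx P))/proper_neq.
  by rewrite eq_sym.
rewrite (isog_pgroup _ (first_isog V)).
apply: (@pgroupS _ _ (fmod abA @* (alpha @* P))); last by rewrite !morphim_pgroup.
by apply/subsetP=> x _; rewrite -[x]fmvalK mem_morphim ?fmodP.
Qed.

(** By [Sylow_conj_cent], fusion in a Sylow subgroup P happens in ['N_G(P)], the product of P and a
    p'-core centralising P, hence in P itself. So [control_fusion_normal] gives a proper normal [K]
    with p-power index; by induction [K] is p-nilpotent, and its p'-core is a normal p-complement of
    [G]. *)
Lemma Frobenius_pnil (p : nat) (gT : finGroupType) (G : {group gT}) :
    (forall E : {group gT}, E \subset G -> p.-group E -> E :!=: 1 ->
       pnil p 'N_G(E)) ->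
  pnil p G.
Proof.
have [n] := ubnP #|G|; elim: n => // n IHn in G * => ltGn locG.
have [P sylP] := Sylow_exists p G; have [sPG pP p'i] := and3P sylP.
have [P1 | ntP] := eqVneq (gval P) 1.
  apply: (@pnilI _ _ G G) => //; last by rewrite trivg_quotient pgroup1.
  by rewrite -partG_eq1 -(card_Hall sylP) P1 cards1.
have [] := control_fusion_normal sylP ntP.
  move=> x g Px Gg Pxg.
  have sylPg: p.-Sylow(G) (P :^ g) by rewrite pHallJ.
  have [c /setIP[Gc cc] defP] := Sylow_conj_cent locG sylPg sylP.
  have Ngc: g * c \in 'N_G(P).
    by rewrite inE groupM //=; apply/normP; rewrite conjsgM -defP.
  have xgc: x ^ (g * c) = x ^ g.
    rewrite conjgM; apply/conjg_fixP/commgP.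
    by apply: commute_sym; apply: (centP cc); rewrite inE memJ_conjg Px.
  have pN: pnil p 'N_G(P) by apply: locG.
  have sylPN: p.-Sylow('N_G(P)) P by rewrite Sylow_subnorm.
  have cOP: 'O_p^'('N_G(P)) \subset 'C(P).
    by apply: pnil_p'pcore_cent pN pP _; rewrite normal_subnorm.
  move: Ngc; rewrite -(pnil_mulg pN sylPN) => /mulsgP[v u Ov Pu defgc].
  exists u => //; rewrite -xgc defgc conjgM; congr (_ ^ u).
  by apply/conjg_fixP/commgP/commute_sym; apply: (centP (subsetP cOP v Ov)).
move=> K [nsKG ltKG pGK]; have [sKG nKG] := andP nsKG.
have pK: pnil p K.
  apply: IHn => [|E sEK pE ntE]; first exact: leq_trans (proper_card ltKG) ltGn.
  apply: pnilS (locG E _ pE ntE); first exact: setSI.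
  exact: subset_trans sEK sKG.
apply: (@pnilI _ _ G 'O_p^'(K)).
- exact: gFnormal_trans.
- exact: pcore_pgroup.
rewrite /pgroup card_quotient ?gFnorm_trans //.
rewrite -(Lagrange_index sKG (pcore_sub _ _)) pnatM -!card_quotient ?gFnorm //.
exact/andP.
Qed.

(** * Coprime action *)

Section CoprimeAbelian.
Variable gT : finGroupType.
Implicit Types A B G P Q V Y : {group gT}.

(** [A] acts trivially on [G / [~: G, A]], and under coprime action fixed points of the quotient
    lift to fixed points of [G]. *)
Lemma coprime_abel_mulg A G :
  A \subset 'N(G) -> coprime #|G| #|A| -> abelian G -> [~: G, A] * 'C_G(A) = G.
Proof.
move=> nGA coGA abG.
have sRG: [~: G, A] \subset G by rewrite commg_subl.
have nRA: A \subset 'N([~: G, A]) by apply: commg_normr.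
have nRG: G \subset 'N([~: G, A]) by apply: commg_norml.
have cGA: G / [~: G, A] \subset 'C(A / [~: G, A]) by rewrite quotient_cents2r.
have := coprime_quotient_cent sRG nRA coGA (abelian_sol abG).
rewrite (setIidPl cGA) => /(congr1 (fun X => coset [~: G, A] @*^-1 X)).
by rewrite /= !quotientK ?subIset ?nRG //= => ->; apply/mulSGid.
Qed.

(* The A x B lemma, for an abelian p-group V. *)
Lemma pgroup_cent_AxB (p : nat) P V Y :
    p.-group P -> p.-group V -> abelian V -> p^'.-group Y ->
    P \subset 'N(V) -> Y \subset 'N(V) -> P \subset 'C(Y) ->
  'C_V(P) \subset 'C(Y) -> V \subset 'C(Y).
Proof.
move=> pP pV abV p'Y nVP nVY cPY cVPY; apply/commG1P.
have nRP: P \subset 'N([~: V, Y]) by rewrite normsR // cents_norm.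
have sRV: [~: V, Y] \subset V by rewrite commg_subl.
have pPR: p.-group (P <*> [~: V, Y]).
  by rewrite norm_joinEl // pgroupM pP (pgroupS sRV).
(* A nontrivial [[~: V, Y]] would meet the centre of this p-group. The intersection lies in
   ['C_V(P)], so [Y] fixes it, yet [Y] has only trivial fixed points on [[~: V, Y]]. *)
apply: (TI_center_nil (pgroup_nil pPR)).
  by rewrite /normal joing_subr join_subG nRP normG.
apply/trivgP; rewrite -(coprime_abel_cent_TI nVY (pnat_coprime pV p'Y) abV).
rewrite subsetI subsetIl; apply: subset_trans cVPY.
rewrite subsetI subIset ?sRV //= subIset //; apply/orP; right.
by rewrite subIset // centS ?orbT // joing_subl.
Qed.

(* Summing over j the identities sum_k x^((c b^j)^k) = 0 leaves p x, since for
   k > 0 the terms regroup into sums over the powers of b^k. *)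
Lemma semiregular_abelem_trivial (p : nat) Q (b c x : gT) :
    prime p -> abelian Q -> b \in 'N(Q) -> c \in 'N(Q) -> commute b c ->
    b ^+ p = 1 -> c ^+ p = 1 ->
    (forall k, 0 < k < p -> 'C_Q[b ^+ k] = 1) ->
    (forall j, 'C_Q[c * b ^+ j] = 1) ->
  x \in Q -> x ^+ p = 1.
Proof.
move=> p_pr abQ nQb nQc cbc bp1 cp1 regb regcb Qx.
case: p => [//|p'] in p_pr bp1 cp1 regb *; set p := p'.+1 in p_pr bp1 cp1 regb *.
pose N d (u : fmod_of abQ) := (\sum_(k < p) u ^@ (d ^+ k))%R.
(* The sum is fixed by [d], because [d ^+ p = 1] makes [d] permute its terms cyclically. *)
have N0 d u : d \in 'N(Q) -> d ^+ p = 1 -> 'C_Q[d] = 1 -> N d u = 0%R.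
  move=> nQd dp1 regd; apply: val_inj => /=; apply/set1gP; rewrite -regd inE fmodP.
  apply/cent1P/commgP/conjg_fixP.
  rewrite -[LHS](fmvalJ (N d u) nQd); congr (fmval _); rewrite /N actr_sum.
  rewrite (eq_bigr (fun k : 'I_p => u ^@ (d ^+ k.+1)%g)%R) => [|k _]; last first.
    by rewrite expgSr actrM ?groupX.
  rewrite big_ord_recr big_ord_recl /= dp1 actr1 GRing.addrC.
  by [].
have nQbk k : b ^+ k \in 'N(Q) by rewrite groupX.
pose u := fmod abQ x.
have: (\sum_(j < p) N (c * b ^+ j)%g u = 0)%R.
  apply: big1 => j _; apply: N0 => //; first by rewrite groupM.
  by rewrite expgMn ?cp1 -?expgM ?mul1g 1?mulnC ?expgM ?bp1 ?expg1n //; apply: commuteX.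
rewrite exchange_big /=.
have pgt0 := prime_gt0 p_pr.
rewrite (bigD1 (Ordinal pgt0)) //= [X in (_ + X)%R]big1 ?GRing.addr0 => [|k nk0]; last first.
  have k_gt0: 0 < k by move: nk0; rewrite -val_eqE lt0n.
  apply: etrans (N0 (b ^+ k) (u ^@ (c ^+ k))%R _ _ _) => //.
  - apply: eq_bigr => j _; rewrite expgMn; last exact: commuteX.
    by rewrite actrM ?groupX // -!expgM mulnC.
  - by rewrite -expgM mulnC expgM bp1 expg1n.
  by apply: regb; rewrite k_gt0 /=.
rewrite (eq_bigr (fun _ => u)) => [|j _]; last by rewrite expg0 actr1.
rewrite GRing.sumr_const card_ord => /(congr1 fmval); rewrite fmvalZ.
by rewrite /u fmodK.
Qed.

End CoprimeAbelian.

(** * Index bounds for centralisers under elementary abelian action *)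

(** Choose [B] maximal such that [A] does not centralise ['C_Q(B)]. Then elements of [A] outside [B]
    have only trivial fixed points on [Q2 = [~: 'C_Q(B), A]]. If the index were not p, elements [b]
    and [c] independent modulo [B] would, by [semiregular_abelem_trivial], give the p'-group [Q2]
    exponent dividing p; then [Q2 = 1], against the choice of [B]. *)
Lemma abelem_act_hyperplane (p : nat) (gT : finGroupType) (A Q : {group gT}) :
    prime p -> p.-abelem A -> abelian Q -> p^'.-group Q -> A \subset 'N(Q) ->
    ~~ (A \subset 'C(Q)) ->
  exists B : {group gT},
    [/\ B \subset A, #|A : B| = p & ~~ (A \subset 'C('C_Q(B)))].
Proof.
move=> p_pr abelA abQ p'Q nQA ncQA.
have [pA cAA expA] := and3P abelA.
pose W (B : {group gT}) := (B \subset A) && ~~ (A \subset 'C('C_Q(B))).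
have W1 : W 1%G by rewrite /W sub1G cent1T setIT.
have [B /maxgroupP[/andP[sBA ncB] maxB] _] := maxgroup_exists W1.
exists B; split=> //; apply/eqP; apply: contraNT ncB => niB.
have nBA : A \subset 'N(B) by rewrite cents_norm // (centsS sBA).
pose Q1 := 'C_Q(B)%G; pose Q2 := [~: Q1, A]%G.
have nQ1A : A \subset 'N(Q1) by rewrite normsI // norms_cent.
have abQ1 : abelian Q1 := abelianS (subsetIl _ _) abQ.
have p'Q1 : p^'.-group Q1 := pgroupS (subsetIl _ _) p'Q.
have coQ1A : coprime #|Q1| #|A| by rewrite coprime_sym (pnat_coprime pA).
have sQ21 : Q2 \subset Q1 by rewrite commg_subl.
have cQ2A : 'C_Q2(A) = 1 := coprime_abel_cent_TI nQ1A coQ1A abQ1.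
have nQ2A : A \subset 'N(Q2) by rewrite commg_normr.
have regA a : a \in A :\: B -> 'C_Q2[a] = 1.
  case/setDP=> Aa nBa; apply/trivgP; rewrite -cQ2A subsetI subsetIl /=.
  have cQ2a: 'C_Q2[a] \subset 'C_Q(B <*> <[a]>).
    rewrite -cent_cycle centY setIA -/(gval Q1).
    by rewrite setSI.
  rewrite centsC; apply: contraR nBa => ncA.
  have sBaA : B <*> <[a]> \subset A by rewrite join_subG sBA cycle_subG.
  have <- : B <*> <[a]> = B.
    apply: maxB; last exact: joing_subl.
    rewrite /W sBaA; apply: contra ncA => cA.
    by rewrite (subset_trans cA) ?centS.
  by rewrite mem_gen // inE cycle_id orbT.
have [sAB | /subsetPn[b Ab nBb]] := boolP (A \subset B).
  by rewrite centsC subIset // centS ?orbT.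
have ob: #[b] = p.
  by apply: (abelem_order_p abelA Ab); apply: contraNneq nBb => ->.
have [sAB | /subsetPn[c Ac nBbc]] := boolP (A \subset B <*> <[b]>).
  case/eqP: niB; have sBbA : B <*> <[b]> \subset A by rewrite join_subG sBA cycle_subG.
  have defA: A :=: B * <[b]>.
    rewrite -norm_joinEr ?cycle_subG ?(subsetP nBA) //.
    by apply/eqP; rewrite eqEsubset sAB.
  have tiBb: B :&: <[b]> = 1 by rewrite setIC prime_TIg ?cycle_subG // -orderE ob.
  by rewrite -divgS // defA TI_cardMg // -orderE ob mulKn ?cardG_gt0.
have xp1 x : x \in A -> x ^+ p = 1 by apply: (exponentP expA).
have Q2p x : x \in Q2 -> x ^+ p = 1.
  apply: (@semiregular_abelem_trivial _ p Q2 b c x p_pr).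
  - exact: abelianS sQ21 abQ1.
  - exact: (subsetP nQ2A).
  - exact: (subsetP nQ2A).
  - exact: (centsP cAA).
  - exact: xp1.
  - exact: xp1.
  - move=> k /andP[k0 kp]; apply: regA; apply/setDP; split; first exact: groupX.
    apply: contra nBb => Bbk.
    have: coprime #[b] k by rewrite ob prime_coprime // gtnNdvd.
    by rewrite -generator_coprime /generator -cycle_subG => /eqP->; rewrite cycle_subG.
  move=> j; apply: regA; apply/setDP; split; first by rewrite groupM ?groupX.
  apply: contra nBbc => Bcb; rewrite -(mulgK (b ^+ j) c) groupM //.
    by rewrite mem_gen // inE Bcb.
  by rewrite groupV groupX // mem_gen // inE cycle_id orbT.
have Q21 : Q2 :=: 1.
  apply/trivgP/subsetP=> x Q2x; apply/set1gP; apply/eqP.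
  have : coprime #[x] p.
    have := mem_p_elt (pgroupS sQ21 p'Q1) Q2x.
    by rewrite /p_elt coprime_sym p'natE // -prime_coprime.
  have dv : #[x] %| p by rewrite order_dvdn Q2p.
  by rewrite /coprime (gcdn_idPl dv) order_eq1.
by rewrite centsC; apply/commG1P.
Qed.

(* If the index were at most p, a minimal a-invariant Q1 not centralised by a
   would act on W0 = [W, Q1] of order p^2, and the conjugates of C = 'C_W0(a)
   under Q1 would be disjoint.  Then #|Q1| = p + 1 is even and the sets
   C^# :^ x partition W0^#.  But for w in C^# and an involution t of Q1, the
   element w * w ^ t is fixed by t, so the conjugate of C containing it meets its
   image under t. *)
Lemma pgroup_abelian_index_cent
    (p : nat) (gT : finGroupType) (Q W : {group gT}) (a : gT) :
    prime p -> odd p -> p.-elt a -> abelian Q -> p^'.-group Q ->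
    abelian W -> p.-group W ->
    a \in 'N(Q) -> a \in 'N(W) -> Q \subset 'N(W) -> 'C_Q(W) = 1 ->
    ~~ (Q \subset 'C[a]) ->
  p ^ 2 <= #|W : 'C_W[a]|.
Proof.
move=> p_pr p_odd pa abQ0 p'Q0 abW pW nQa0 nWa nWQ0 cQW ncQa.
pose A := <[a]>%G; have pA : p.-group A := pa.
pose R (H : {group gT}) := (A \subset 'N(H)) && ~~ (H \subset 'C(A)).
have RQ : R Q by rewrite /R cycle_subG nQa0 cent_cycle.
have [Q1 /mingroupP[/andP[nQA ncQA] minQ] sQ1Q] := mingroup_exists RQ.
have abQ : abelian Q1 := abelianS sQ1Q abQ0.
have p'Q : p^'.-group Q1 := pgroupS sQ1Q p'Q0.
have nWQ : Q1 \subset 'N(W) := subset_trans sQ1Q nWQ0.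
have nWA : A \subset 'N(W) by rewrite cycle_subG.
have coQA : coprime #|Q1| #|A| by rewrite coprime_sym (pnat_coprime pA).
have coWQ : coprime #|W| #|Q1| := pnat_coprime pW p'Q.
have sQAQ : [~: Q1, A] \subset Q1 by rewrite commg_subl.
have cQAA : 'C_[~: Q1, A](A) = 1 := coprime_abel_cent_TI nQA coQA abQ.
have defQ : [~: Q1, A] = Q1.
  apply: minQ => //; rewrite /R commg_normr; apply: contra ncQA => cR.
  by apply/commG1P; rewrite -cQAA (setIidPl cR).
have regQ : 'C_Q1(A) = 1 by rewrite -defQ.
have irrQ (H : {group gT}) : H \subset Q1 -> A \subset 'N(H) -> H :!=: 1 -> H :=: Q1.
  move=> sHQ nHA ntH; apply: minQ => //; rewrite /R nHA.
  by apply: contra ntH => cHA; rewrite -subG1 -regQ subsetI sHQ.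
have ntQ : Q1 :!=: 1 by apply: contraNneq ncQA => ->; apply: sub1G.
pose W0 := [~: W, Q1]%G.
have sW0 : W0 \subset W by rewrite commg_subl.
have nW0A : A \subset 'N(W0) by rewrite normsR.
have nW0Q : Q1 \subset 'N(W0) by apply: commg_normr.
have cW0Q : 'C_W0(Q1) = 1 := coprime_abel_cent_TI nWQ coWQ abW.
have abW0 : abelian W0 := abelianS sW0 abW.
have pW0 : p.-group W0 := pgroupS sW0 pW.
pose C := 'C_W0(A)%G.
have sCW0 : C \subset W0 := subsetIl _ _.
have leC : #|W0 : C| <= #|W : 'C_W[a]|.
  rewrite -cent_cycle -/(gval A).
  have -> : #|W0 : C| = #|W0 : 'C_W(A)|.
    by rewrite -[RHS]indexgI setIA (setIidPl sW0).
  exact: subset_leq_card (imsetS _ sW0).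
rewrite leqNgt; apply/negP=> lt_p2.
have ltC : #|W0 : C| < p ^ 2 by apply: leq_ltn_trans lt_p2.
have ntW0 : W0 :!=: 1.
  apply: contraNneq ntQ => W01; rewrite -subG1 -cQW subsetI sQ1Q.
  by rewrite centsC; apply/commG1P.
have iC : #|W0 : C| = p.
  have [k defk] := p_natP (pnat_dvd (dvdn_indexg W0 C) pW0).
  move: ltC; rewrite defk ltn_exp2l ?prime_gt1 //.
  case: k defk => [|[|//]] defk _; last by rewrite expn1.
  case/eqP: ntW0.
  (* If [C = W0], the three subgroups lemma makes [[~: Q1, A] = Q1] centralise [W0]. *)
  have cWA : [~: W0, A] = 1.
    apply/commG1P; have : W0 \subset C by rewrite -indexg_eq1 defk.
    by move/subset_trans; apply; apply: subsetIr.
  have : [~: A, Q1, W0] = 1.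
    apply: three_subgroup; last by rewrite cWA comm1G.
    by apply/trivgP; rewrite -cWA commSg // commg_subr.
  rewrite (commGC A) defQ => /commG1P cQW0.
  by apply/trivgP; rewrite -cW0Q subsetI subxx centsC.
(* Both [a] and [a ^ x] fix [C :&: C :^ x] pointwise, hence so does
   [a ^ x * a^-1 = x^-1 * x ^ a^-1], a nontrivial element of [Q1]. By minimality all of [Q1] does,
   and ['C_W0(Q1) = 1]. *)
have TIC x : x \in Q1 -> x != 1 -> C :&: C :^ x = 1.
  move=> Qx ntx; pose D := (C :&: C :^ x)%G; pose T := 'C_Q1(D)%G.
  have cDA : A \subset 'C(D) by rewrite centsC subIset // subsetIr.
  have nTA : A \subset 'N(T) by rewrite normsI // norms_cent // cents_norm.
  have Ty : x^-1 * x ^ a^-1 \in T.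
    have aV : a^-1 \in A by rewrite groupV cycle_id.
    rewrite inE groupM ?groupV ?memJ_norm ?(subsetP nQA) //=.
    have -> : x^-1 * x ^ a^-1 = a ^ x * a^-1 by rewrite /conjg invgK !mulgA.
    apply: groupM; last exact: (subsetP cDA).
    apply/centP=> d /setIP[_].
    case/imsetP=> c /setIP[_ /centP cAc] ->; apply/commgP.
    rewrite -conjRg conjg_eq1; apply/commgP.
    by apply/commute_sym/cAc/cycle_id.
  have ntT : T :!=: 1.
    apply: contraNneq ntx => T1; apply/eqP/set1gP; rewrite -regQ inE Qx cent_cycle.
    have /eqP : x^-1 * x ^ a^-1 = 1 by apply/set1gP; rewrite -T1.
    rewrite -eq_mulVg1 eq_sym => /eqP/conjg_fixP/commgP cxa.
    by apply/cent1P; rewrite -[a]invgK; apply: commuteV.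
  apply/trivgP; rewrite -cW0Q subsetI subIset ?sCW0 //=.
  have defT : T :=: Q1 := irrQ T (subsetIl _ _) nTA ntT.
  have sQT : Q1 \subset T by rewrite defT.
  by rewrite centsC; apply: subset_trans sQT (subsetIr _ _).
have ntC : C :!=: 1.
  have pAW : p.-group (A <*> W0) by rewrite norm_joinEl // pgroupM pA.
  have nsW0 : W0 <| A <*> W0 by rewrite /normal joing_subr join_subG nW0A normG.
  apply: contraNneq (meet_center_nil (pgroup_nil pAW) nsW0 ntW0) => C1.
  rewrite -subG1 -C1 subsetI subsetIl subIset // subIset ?centS ?orbT //.
  exact: joing_subl.
have [x Qx ntx] := trivgPn _ ntQ.
have oC : #|C| = p.
  have sCC : C * C :^ x \subset W0.
    rewrite mul_subG //; by rewrite -(normsP nW0Q x Qx) conjSg.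
  have := subset_leq_card sCC; rewrite TI_cardMg ?TIC // cardJg.
  rewrite -(Lagrange sCW0) iC leq_pmul2l // => leCp.
  apply/eqP; rewrite eqn_leq leCp dvdn_leq //.
  by have [] := pgroup_pdiv (pgroupS sCW0 pW0) ntC.
have oW0 : #|W0| = (p ^ 2)%N by rewrite -(Lagrange sCW0) iC oC.
have tiC : normedTI C^# Q1 1.
  apply/normedTI_P; split; first by rewrite setD_eq0 subG1.
    by rewrite sub1G.
  move=> g Qg; apply: contraR; rewrite inE => ntg.
  rewrite -setI_eq0 -subset0; apply/subsetP=> y /setIP[/setD1P[nty Cy]].
  rewrite conjD1g => /setD1P[_ Cgy]; rewrite inE -(negPf nty).
  by apply/eqP/set1gP; rewrite -(TIC g Qg ntg) inE Cy.
have sCS : class_support C^# Q1 \subset W0^#.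
  rewrite class_supportEr; apply/bigcupsP=> y Qy.
  by rewrite conjD1g setSD // -(normsP nW0Q y Qy) conjSg.
have oS : #|class_support C^# Q1| = ((p - 1) * #|Q1|)%N.
  by rewrite (card_support_normedTI tiC) indexg1 -oC (cardsD1 1 C) group1 addKn.
have oW1 : #|W0^#| = ((p - 1) * (p + 1))%N.
  by rewrite -subn_sqr exp1n -oW0 (cardsD1 1 W0) group1 addKn.
have p1_gt0 : 0 < p - 1 by rewrite subn_gt0 prime_gt1.
have modQ : #|Q1| = 1 %[mod p].
  have actQ : [acts A, on Q1 | 'J] by rewrite astabsJ.
  by rewrite (pgroup_fix_mod pA actQ) afixJ regQ cards1.
(* The conjugates fit into [W0^#], so [#|Q1|] is at most p + 1; it exceeds 1 and is congruent to 1
   modulo p. *)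
have oQ : #|Q1| = (p + 1)%N.
  apply/eqP; rewrite eqn_leq; have := subset_leq_card sCS.
  rewrite oS oW1 leq_pmul2l // => -> /=.
  have Q_gt1 : 1 < #|Q1| by rewrite cardG_gt1.
  move/eqP: modQ; rewrite eqn_mod_dvd ?(ltnW Q_gt1) // => /dvdn_leq.
  by rewrite subn_gt0 Q_gt1 => /(_ isT); rewrite leq_subRL 1?addnC // ltnW.
have defS : class_support C^# Q1 = W0^#.
  by apply/eqP; rewrite eqEcard sCS oS oQ oW1 leqnn.
have [t Qt ot] : {t | t \in Q1 & #[t] = 2} by apply: Cauchy; rewrite // oQ addn1 dvdn2 /= p_odd.
have [w Cw ntw] := trivgPn _ ntC.
have ntt : t != 1 by rewrite -order_gt1 ot.
have W0w := subsetP sCW0 w Cw.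
have W0wt : w ^ t \in W0 by rewrite memJ_norm ?(subsetP nW0Q).
pose v := w * w ^ t.
have vt : v ^ t = v.
  rewrite /v conjMg -conjgM -[t * t]/(t ^+ 2) -ot expg_order conjg1.
  exact: (centsP abW0).
have ntv : v != 1.
  apply: contra ntw => /eqP v1; rewrite -(inj_eq (conjg_inj t)) conj1g.
  apply/eqP/set1gP; rewrite -(TIC t Qt ntt) inE memJ_conjg Cw andbT.
  by rewrite -[w ^ t](mulKg w) -/v v1 mulg1 groupV.
have : v \in W0^# by rewrite !inE ntv groupM.
rewrite -defS class_supportEr => /bigcupP[y Qy].
rewrite conjD1g => /setD1P[_]; rewrite mem_conjg => Cv.
case/eqP: ntv; rewrite -[v](conjgKV y); apply/eqP; rewrite conjg_eq1; apply/eqP/set1gP.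
rewrite -(TIC t Qt ntt) inE Cv /= -{1}vt -conjgM (centsP abQ _ Qt) ?groupV //.
by rewrite conjgM memJ_conjg.
Qed.

(** Induction along the hyperplane [B] of [abelem_act_hyperplane]: ['C_V(B)] has index at least
    [#|B|] in [V], and an [a] acting nontrivially on ['C_Q(B)] contributes a further factor of at
    least [p ^ 2], whereas [#|A|] is only p times [#|B|]. *)
Lemma abelem_lt_index_cent (p : nat) (gT : finGroupType) (A Q V : {group gT}) :
    prime p -> odd p -> p.-abelem A -> abelian Q -> p^'.-group Q ->
    abelian V -> p.-group V ->
    A \subset 'N(Q) -> A \subset 'N(V) -> Q \subset 'N(V) ->
    'C_A(Q) = 1 -> 'C_Q(V) = 1 -> A :!=: 1 ->
  #|A| < #|V : 'C_V(A)|.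
Proof.
move=> p_pr p_odd; have [n] := ubnP #|A|.
elim: n => // n IHn in A * => leAn abelA abQ p'Q abV pV nQA nVA nVQ cAQ cQV ntA.
have [pA cAA _] := and3P abelA.
have ncAQ : ~~ (A \subset 'C(Q)).
  by apply: contra ntA => cA; rewrite -subG1 -cAQ subsetI subxx.
have [B [sBA iB ncB]] := abelem_act_hyperplane p_pr abelA abQ p'Q nQA ncAQ.
have oA : #|A| = (#|B| * p)%N by rewrite -iB Lagrange.
have nBA : A \subset 'N(B) by rewrite cents_norm // (centsS sBA).
have leB : #|B| <= #|V : 'C_V(B)|.
  have [-> | ntB] := eqVneq (gval B) 1; first by rewrite cards1 indexg_gt0.
  apply/ltnW/IHn => //; try exact: subset_trans sBA _.
  - by apply: (@leq_trans #|A|) => //; rewrite oA ltn_Pmulr ?prime_gt1.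
  - exact: abelemS sBA abelA.
  by apply/trivgP; rewrite -cAQ setSI.
have [a Aa nca] := subsetPn ncB.
have sWV : 'C_V(B) \subset V := subsetIl _ _.
(* By [pgroup_cent_AxB], a subgroup of ['C_Q(B)] that acts trivially on ['C_V(B)] acts trivially on
   [V]. *)
have cQW : 'C_('C_Q(B))('C_V(B)) = 1.
  pose Y := 'C_('C_Q(B))('C_V(B))%G; rewrite -/(gval Y).
  have sYQ : Y \subset Q by rewrite subIset // subsetIl.
  apply/trivgP; rewrite -cQV subsetI sYQ centsC.
  apply: (@pgroup_cent_AxB _ p B V Y) => //.
  - exact: pgroupS sBA pA.
  - exact: pgroupS sYQ p'Q.
  - exact: subset_trans sBA nVA.
  - exact: subset_trans sYQ nVQ.
  - by rewrite centsC subIset // subsetIr.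
  by rewrite centsC subsetIr.
have leW : p ^ 2 <= #|'C_V(B) : 'C_('C_V(B))[a]|.
  apply: (@pgroup_abelian_index_cent p _ 'C_Q(B) 'C_V(B) a) => //.
  - exact: mem_p_elt pA Aa.
  - exact: abelianS (subsetIl _ _) abQ.
  - exact: pgroupS (subsetIl _ _) p'Q.
  - exact: abelianS sWV abV.
  - exact: pgroupS sWV pV.
  - by apply: (subsetP _ a Aa); rewrite normsI // norms_cent.
  - by apply: (subsetP _ a Aa); rewrite normsI // norms_cent.
  - by rewrite normsI ?norms_cent ?(subset_trans (subsetIl _ _) nVQ) // cents_norm // subsetIr.
  by rewrite -sub_cent1 in nca *.
have sCC : 'C_V(A) \subset 'C_('C_V(B))[a].
  by rewrite -setIA setIS // subsetI centS // -cent_cycle centS ?cycle_subG.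
apply: (leq_trans _ (dvdn_leq _ (indexgS V sCC))); rewrite ?indexg_gt0 //.
rewrite -(Lagrange_index sWV (subsetIl _ _)).
apply: (leq_trans _ (leq_mul leB leW)).
by rewrite oA -mulnn mulnA ltn_Pmulr ?prime_gt1 // muln_gt0 cardG_gt0 prime_gt0.
Qed.

(** The previous bound is applied modulo [E]. As [V] may meet [E], it is first replaced by [U =
    [~: V, Q]], which is disjoint from [E] since ['C_U(Q) = 1]; [Q] stays faithful on [U] because
    [V = U * 'C_V(Q)]. *)
Lemma pgroup_lt_index_cent (p : nat) (gT : finGroupType) (A Q V E : {group gT}) :
    prime p -> odd p -> E \subset A -> p.-abelem (A / E) ->
    abelian Q -> p^'.-group Q -> abelian V -> p.-group V -> p.-group E ->
    A \subset 'N(E) -> A \subset 'N(Q) -> A \subset 'N(V) -> Q \subset 'N(V) ->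
    E \subset 'C(Q) -> E \subset 'C(V) -> 'C_A(Q) \subset E -> 'C_Q(V) = 1 ->
    ~~ (A \subset E) ->
  #|A : E| < #|V : 'C_V(A)|.
Proof.
move=> p_pr p_odd sEA abelA abQ p'Q abV pV pE nEA nQA nVA nVQ cEQ cEV cAQ cQV nsAE.
have coVQ : coprime #|V| #|Q| := pnat_coprime pV p'Q.
pose U := [~: V, Q]%G.
have sUV : U \subset V by rewrite commg_subl.
have cUQ : 'C_U(Q) = 1 := coprime_abel_cent_TI nVQ coVQ abV.
have nUA : A \subset 'N(U) by rewrite normsR.
have nUQ : Q \subset 'N(U) by apply: commg_normr.
have nEQ : Q \subset 'N(E) by rewrite cents_norm // centsC.
have nEV : V \subset 'N(E) by rewrite cents_norm // centsC.
have nEU := subset_trans sUV nEV.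
have tiEQ : Q :&: E = 1 by rewrite setIC (coprime_TIg (pnat_coprime pE p'Q)).
have tiUE : U :&: E = 1 by apply/trivgP; rewrite -cUQ setIS.
have cQU : 'C_Q(U) = 1.
  apply/trivgP; rewrite -cQV subsetI subsetIl /= centsC.
  apply: (@subset_trans _ _ (U * 'C_V(Q))).
    by rewrite (coprime_abel_mulg nVQ coVQ abV).
  rewrite mul_subG //; first by rewrite centsC subsetIr.
  exact: subset_trans (subsetIr _ _) (centS (subsetIl _ _)).
have oAE : #|A / E| = #|A : E| by rewrite card_quotient.
have ltAE : #|A / E| < #|U / E : 'C_(U / E)(A / E)|.
  apply: (@abelem_lt_index_cent p _ (A / E) (Q / E) (U / E)) => //.
  - exact: quotient_abelian.
  - exact: quotient_pgroup.
  - exact: quotient_abelian (abelianS sUV abV).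
  - exact: quotient_pgroup (pgroupS sUV pV).
  - exact: quotient_norms.
  - exact: quotient_norms.
  - exact: quotient_norms.
  - rewrite -[LHS]cosetpreK; set X := (_ @*^-1 _).
    have sXA : X \subset A.
      by rewrite sub_cosetpre_quo ?subsetIl // /normal sEA.
    have nEX := subset_trans sXA nEA.
    apply/quotientS1; apply: subset_trans cAQ; rewrite subsetI sXA.
    apply/commG1P/trivgP; rewrite -tiEQ subsetI commg_subr (subset_trans sXA nQA).
    by rewrite -quotient_cents2 // /X cosetpreK subsetIr.
  - pose X := (Q :&: coset E @*^-1 'C(U / E))%G.
    have defX : X / E = 'C_(Q / E)(U / E) by rewrite /quotient morphim_setIpre.
    have nEX : X \subset 'N(E) := subset_trans (subsetIl _ _) nEQ.
    rewrite -defX; apply/quotientS1; apply: subset_trans (sub1G E).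
    rewrite -cQU subsetI subsetIl.
    apply/commG1P/trivgP; rewrite -tiUE subsetI commg_subr.
    rewrite (subset_trans (subsetIl _ _) nUQ) //=.
    by rewrite -quotient_cents2 // defX subsetIr.
  by rewrite -subG1 quotient_sub1.
rewrite -oAE; apply: (leq_trans ltAE).
rewrite -(quotient_TI_subcent nUA nEA tiUE).
apply: (@leq_trans #|U : 'C_U(A)|).
  by apply: dvdn_leq; rewrite ?indexg_gt0 // index_quotient // subIset ?nEU.
have -> : #|U : 'C_U(A)| = #|U : 'C_V(A)| by rewrite -[RHS]indexgI setIA (setIidPl sUV).
exact: subset_leq_card (imsetS _ sUV).
Qed.

(** * Thompson's normal p-complement theorem *)

(** The hypothesis of Thompson's theorem, over all Sylow p-subgroups so that no choice has to be
    carried along. *)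
Definition char_pnil (p : nat) (gT : finGroupType) (G : {group gT}) :=
  forall P D : {group gT},
    p.-Sylow(G) P -> D \char P -> D :!=: 1 -> pnil p 'N_G(D).

Lemma char_pnilS (p : nat) (gT : finGroupType) (G U P : {group gT}) :
  p.-Sylow(G) P -> P \subset U -> U \subset G -> char_pnil p G -> char_pnil p U.
Proof.
move=> sylP sPU sUG chG S D sylS chD ntD.
apply: (@pnilS p gT 'N_G(D)); first exact: setSI.
apply: chG chD ntD; rewrite pHallE (subset_trans (pHall_sub sylS)) //=.
by rewrite (card_Hall sylS) -(card_Hall (pHall_subl sPU sUG sylP)) (card_Hall sylP).
Qed.

(** A Sylow subgroup P maps isomorphically onto [P / R], so characteristic subgroups lift. The
    Frattini argument for D in [D <*> R] shows that the normaliser of the image of D is covered by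
    ['N_G(D)]. *)
Lemma char_pnil_p'quotient (p : nat) (gT : finGroupType) (G R : {group gT}) :
  R <| G -> p^'.-group R -> char_pnil p G -> char_pnil p (G / R).
Proof.
move=> nsRG p'R chG Pb Db sylPb chDb ntDb; have [sRG nRG] := andP nsRG.
have [P0 sylP0] := Sylow_exists p G.
have sP0N := subset_trans (pHall_sub sylP0) nRG.
have [_ /morphimP[x Nx Gx ->] defPb] := Sylow_trans (quotient_pHall sP0N sylP0) sylPb.
pose P := (P0 :^ x)%G; have sylP : p.-Sylow(G) P by rewrite pHallJ.
have [sPG pP _] := and3P sylP; have nRP := subset_trans sPG nRG.
have {}defPb : Pb :=: P / R by rewrite defPb quotientJ.
have tiRP : P :&: R = 1 := coprime_TIg (pnat_coprime pP p'R).
pose f := restrm_morphism nRP (coset_morphism R).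
have injf : 'injm f by rewrite ker_restrm ker_coset tiRP.
have imf (B : {group gT}) : B \subset P -> f @* B = B / R.
  by move=> sBP; rewrite morphim_restrm (setIidPr sBP).
pose D := (f @*^-1 Db)%G.
have sDP : D \subset P by apply: subsetIl.
have defDb : D / R = Db.
  by rewrite -imf // morphpreK // imf // -defPb char_sub.
have chD : D \char P.
  by rewrite -(char_injm injf (subxx P) sDP) !imf // defDb -defPb.
have ntD : D :!=: 1.
  by apply: contraNneq ntDb => D1; rewrite -defDb D1 quotient1.
have nRD := subset_trans sDP nRP.
have pND := chG P D sylP chD ntD.
have sub : 'N_(G / R)(Db) \subset 'N_G(D) / R.
  have nsRDR : R <| D <*> R by rewrite /normal joing_subr join_subG nRD normG.
  have -> : 'N_(G / R)(Db) = 'N_G(D <*> R) / R.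
    by rewrite quotient_subnormG // quotientYidr // defDb.
  have sylD : p.-Sylow(D <*> R) D.
    have [] // := coprime_mulpG_Hall (esym (norm_joinEl nRD)) _ p'R.
    exact: pgroupS sDP pP.
  have nsDRN : D <*> R <| 'N_G(D <*> R).
    by rewrite normal_subnorm join_subG sRG (subset_trans sDP sPG).
  rewrite -(Frattini_arg nsDRN sylD) quotientMl; last first.
    by rewrite join_subG nRD normG.
  rewrite quotientYidr // mul_subG ?quotientS //.
    by rewrite subsetI normG (subset_trans sDP sPG).
  by rewrite setSI // subsetIl.
apply: pnilS sub _; apply: pnil_quotient pND.
by rewrite subIset // nRG.
Qed.

Lemma pgroup_quotient_ext (p : nat) (gT : finGroupType) (G K : {group gT}) :
  G \subset 'N(K) -> p.-group (G / K) -> p.-group (K :&: G) -> p.-group G.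
Proof.
move=> nKG pGK pKG; rewrite /pgroup -(Lagrange (subsetIr K G)) pnatM.
rewrite [p.-nat #|_ :&: _|]pKG -card_quotient ?normsI ?normG //=.
by rewrite (card_isog (second_isog nKG)).
Qed.

(** In [C = 'C_K(D)] the Hall subgroup [D :&: C] is central, so its Schur-Zassenhaus complement is a
    normal p'-subgroup of [C] and lies in the trivial p'-core of [K]. *)
Lemma p'core1_subcent_pgroup (p : nat) (gT : finGroupType) (K D : {group gT}) :
    D <| K -> p.-group D -> p^'.-group (K / D) -> 'O_p^'(K) = 1 ->
  'C_K(D) \subset D.
Proof.
move=> nsDK pD p'KD OK1; have [sDK nDK] := andP nsDK.
pose C := 'C_K(D)%G; pose Z := (D :&: C)%G.
have nsCK : C <| K by rewrite /normal subsetIl normsI ?normG ?norms_cent.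
have sCK := normal_sub nsCK.
have nsZC : Z <| C by rewrite /normal subsetIr normsI ?normG ?(subset_trans sCK).
have pZ : p.-group Z := pgroupS (subsetIl _ _) pD.
have p'CZ : p^'.-group (C / Z).
  rewrite (isog_pgroup _ (second_isog (subset_trans sCK nDK))).
  exact: pgroupS (quotientS _ sCK) p'KD.
have hallZ : p.-Hall(C) Z.
  by rewrite /pHall subsetIr pZ -card_quotient ?normal_norm.
have /splitsP[H /complP[tiZH defC]] := SchurZassenhaus_split (pHall_Hall hallZ) nsZC.
have sHC : H \subset C by rewrite -defC mulG_subr.
have cZH : Z \subset 'C(H).
  by rewrite centsC (subset_trans sHC) // (subset_trans (subsetIr _ _)) // centS // subsetIl.
have nsHC : H <| C by rewrite /normal sHC -defC mul_subG ?normG // cents_norm.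
have p'H : p^'.-group H.
  have oH : #|C / Z| = #|H|.
    rewrite -defC quotientMidl card_quotient; last first.
      by rewrite (subset_trans sHC) ?normal_norm.
    by rewrite -indexgI setIC tiZH indexg1.
  by rewrite /pgroup -oH.
have H1 : H :=: 1.
  apply/trivgP; rewrite -OK1; apply: subset_trans (pcore_max p'H nsHC) _.
  by rewrite pcore_max ?pcore_pgroup // gFnormal_trans.
by move: defC; rewrite H1 mulg1 => /setIidPr.
Qed.

(** For n the p-rank of [P] this is the Thompson subgroup J(P). *)
Lemma pElem_max_gen_char (p n : nat) (gT : finGroupType) (P : {group gT}) :
  <<\bigcup_(A in 'E_p^n(P)) A>> \char P.
Proof.
set J := <<_>>; have sJP : J \subset P.
  by rewrite gen_subG; apply/bigcupsP=> A /pnElemP[].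
apply/charP; split=> // f injf fP; apply/eqP; rewrite eqEcard card_injm // leqnn andbT.
rewrite sub_morphim_pre // gen_subG; apply/bigcupsP=> A EA.
have sAP : A \subset P by case/pnElemP: EA.
rewrite -sub_morphim_pre // sub_gen // (bigcup_max (f @* A)%G) //.
by rewrite -[in X in _ \in X](group_inj fP) injm_pnElem.
Qed.

(* Choose a p-local subgroup that is not p-nilpotent, with largest p-part: if it
   were proper, it would inherit the hypothesis on characteristic subgroups. *)
Lemma char_pnil_pcore_neq1 (p : nat) (gT : finGroupType) (G : {group gT}) :
    char_pnil p G ->
    (forall U : {group gT}, U \proper G -> char_pnil p U -> pnil p U) ->
    ~~ pnil p G ->
  'O_p(G) != 1.
Proof.
move=> chG IHG npG.
pose bad (E : {group gT}) :=
  [&& E \subset G, p.-group E, E :!=: 1 & ~~ pnil p 'N_G(E)].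
have [E0 badE0] : exists E0, bad E0.
  apply/existsP; apply: contraR npG; rewrite negb_exists => /forallP nbad.
  apply: Frobenius_pnil => E sEG pE ntE; apply: contraR (nbad E) => npE.
  by rewrite /bad sEG pE ntE.
case: (arg_maxnP (fun E : {group gT} => (#|'N_G(E)|`_p)%N) badE0) => E.
case/and4P=> sEG pE ntE npE maxE.
have [nEG | nnEG] := boolP (G \subset 'N(E)).
  apply: contraNneq ntE => Op1; rewrite -subG1 -Op1 pcore_max //.
  exact/andP.
case/negP: npE; apply: IHG.
  rewrite properEneq subsetIl andbT; apply: contra nnEG => /eqP <-.
  exact: subsetIr.
move=> S F sylS chF ntF.
have [sSN pS _] := and3P sylS; have sSG := subset_trans sSN (subsetIl _ _).
have [P sylP sSP] := Sylow_superset sSG pS.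
have [sPG pP _] := and3P sylP.
apply: (@pnilS p gT 'N_G(F)); first by rewrite setSI ?subsetIl.
have [defP | neqSP] := eqVneq (gval S) P.
  by apply: chG chF ntF; rewrite defP.
apply: contraT => npF.
have sFS := char_sub chF.
have badF : bad F by rewrite /bad (subset_trans sFS) // (pgroupS sFS) // ntF.
(* [S] is proper in ['N_P(S)], which normalises the characteristic subgroup [F] of [S]. *)
have := maxE F badF; rewrite /= leqNgt => /negP[].
have ltSP : S \proper P by rewrite properEneq neqSP.
have ltSN := nilpotent_proper_norm (pgroup_nil pP) ltSP.
rewrite -(card_Hall sylS); apply: (leq_trans (proper_card ltSN)).
have pNS : p.-group 'N_P(S) := pgroupS (subsetIl _ _) pP.
rewrite dvdn_leq // -(part_pnat_id pNS) partn_dvd ?cardSg //.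
by rewrite setISS // char_norms.
Qed.

(** The preimage E of a nontrivial characteristic subgroup of P / D is not normal in [G], as it
    would lie in D. So ['N_G(E)], which contains P, is proper and p-nilpotent, and it covers the
    normaliser in the quotient. *)
Lemma char_pnil_quotient_pcore (p : nat) (gT : finGroupType) (G : {group gT}) :
    char_pnil p G ->
    (forall U : {group gT}, U \proper G -> char_pnil p U -> pnil p U) ->
  char_pnil p (G / 'O_p(G)).
Proof.
move=> chG IHG Pb Eb sylPb chEb ntEb.
set D := 'O_p(G) in Pb Eb sylPb chEb ntEb *.
have nsDG : D <| G := pcore_normal p G; have [sDG nDG] := andP nsDG.
have pD : p.-group D := pcore_pgroup p G.
have [P defPb sDP sPG] := inv_quotientS nsDG (pHall_sub sylPb).
have nsDP : D <| P by rewrite /normal sDP (subset_trans sPG).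
have sylP : p.-Sylow(G) P by rewrite -(pquotient_pHall pD) // -defPb.
have nsEP : Eb <| P / D by rewrite -defPb char_normal.
have [E defEb sDE nsE] := inv_quotientN nsDP nsEP.
have sEP := normal_sub nsE; have sEG := subset_trans sEP sPG.
have nsDE : D <| E by rewrite /normal sDE (subset_trans sEG).
apply: (@pnilS p _ ('N_G(E) / D)%G).
  by rewrite /= quotient_subnormG // defEb.
apply: pnil_quotient; first by rewrite subIset ?nDG.
have sPN : P \subset 'N_G(E) by rewrite subsetI sPG normal_norm.
apply: IHG; last exact: char_pnilS sylP sPN (subsetIl _ _) chG.
rewrite properEneq subsetIl andbT; apply: contraNneq ntEb => defN.
have nsEG : E <| G by rewrite /normal sEG -{1}defN subsetIr.
rewrite defEb; apply/eqP/quotientS1/pcore_max => //.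
exact: pgroupS sEP (pHall_pgroup sylP).
Qed.

(** * Structure of a minimal counterexample to Thompson's theorem *)

Section MinimalCounterexample.

Variables (p : nat) (gT : finGroupType) (G P : {group gT}).
Hypotheses (p_pr : prime p) (p_odd : odd p).
Hypothesis sylP : p.-Sylow(G) P.
Hypothesis chG : char_pnil p G.
Hypothesis IHG : forall U : {group gT}, U \proper G -> P \subset U -> pnil p U.
Hypothesis npG : ~~ pnil p G.
Hypothesis Op'1 : 'O_p^'(G) = 1.

Local Notation D := 'O_p(G).
Local Notation Kb := 'O_p^'(G / D).
Hypothesis pnGD : pnil p (G / D).

Let sPG : P \subset G. Proof. exact: pHall_sub sylP. Qed.
Let pP : p.-group P. Proof. exact: pHall_pgroup sylP. Qed.
Let pD : p.-group D. Proof. exact: pcore_pgroup. Qed.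
Let nsDG : D <| G. Proof. exact: pcore_normal. Qed.
Let sDG : D \subset G. Proof. exact: pcore_sub. Qed.
Let nDG : G \subset 'N(D). Proof. exact: gFnorm. Qed.
Let sDP : D \subset P. Proof. exact: pcore_sub_Hall sylP. Qed.
Let nDP : P \subset 'N(D). Proof. exact: subset_trans sPG nDG. Qed.

Let ntP : P :!=: 1.
Proof.
apply: contraNneq npG => P1; apply: (@pnilI _ _ G G) => //.
  by rewrite -partG_eq1 -(card_Hall sylP) P1 cards1.
by rewrite trivg_quotient pgroup1.
Qed.

Let sylPb : p.-Sylow(G / D) (P / D).
Proof. exact: quotient_pHall sylP. Qed.

Let defGb : Kb * (P / D) = G / D.
Proof. exact: pnil_mulg pnGD sylPb. Qed.

Let normal_pnil_pgroup (H : {group gT}) : H <| G -> pnil p H -> H \subset D.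
Proof.
move=> nsHG pnH; apply: pcore_max => //; apply: (pnil_pgroup pnH).
apply/trivgP; rewrite -Op'1 pcore_max ?pcore_pgroup //.
exact: gFnormal_trans.
Qed.

Let Kbt : Kb != 1.
Proof.
apply: contra npG => /eqP Kb1; apply: pgroup_pnil.
have := pnGD; rewrite /pnil Kb1 -(isog_pgroup _ (quotient1_isog _)).
by rewrite pquotient_pgroup.
Qed.

(** The subgroup usually written O_{p,p'}(G). *)
Let K := (coset D @*^-1 Kb)%G.

Let defKb : K / D = Kb. Proof. exact: cosetpreK. Qed.
Let sDK : D \subset K. Proof. exact: sub_cosetpre. Qed.
Let nsKG : K <| G.
Proof. by rewrite -(quotientGK nsDG) cosetpre_normal pcore_normal. Qed.
Let sKG := normal_sub nsKG.

Let cKD : 'C_K(D) \subset D.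
Proof.
apply: (p'core1_subcent_pgroup (p := p)) => //.
- by rewrite /normal sDK (subset_trans sKG).
- by rewrite defKb pcore_pgroup.
by apply/trivgP; rewrite -Op'1 pcore_max ?pcore_pgroup ?gFnormal_trans.
Qed.

(** The centraliser is a p-group modulo [K] and meets [K] inside [D], so it is a normal
    p-subgroup. *)
Let cGD : 'C_G(D) \subset D.
Proof.
have nsCG : 'C_G(D) <| G by rewrite /normal subsetIl normsI ?normG ?norms_cent.
apply: normal_pnil_pgroup => //; apply: pgroup_pnil.
have nKC : 'C_G(D) \subset 'N(K) by rewrite subIset // normal_norm.
apply: (pgroup_quotient_ext nKC).
  apply: pgroupS (quotientS K (subsetIl G _)) _.
  rewrite -(isog_pgroup _ (third_isog sDK nsDG nsKG)) defKb.
  exact: pnGD.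
apply: pgroupS pD; apply: subset_trans cKD.
by rewrite /= setIA (setIidPl sKG).
Qed.

(* Otherwise P and the preimage of Tb generate a proper, hence p-nilpotent,
   subgroup containing D, whose p'-core lies in 'C_G(D) and so is trivial. *)
Let irrKb (Tb : {group coset_of D}) :
  Tb \subset Kb -> P / D \subset 'N(Tb) -> Tb :!=: 1 -> Tb :=: Kb.
Proof.
move=> sTK nTP ntT; pose U := (coset D @*^-1 (Tb <*> (P / D)))%G.
have sTPG : Tb <*> (P / D) \subset G / D.
  by rewrite join_subG (subset_trans sTK) ?pcore_sub ?quotientS.
have sUG : U \subset G by rewrite sub_cosetpre_quo.
have sDU : D \subset U := sub_cosetpre _.
have sPU : P \subset U by rewrite -sub_quotient_pre // joing_subr.
have defTP : Tb <*> (P / D) = Tb * (P / D) by rewrite norm_joinEr.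
have [defU | neqUG] := eqVneq (gval U) G.
  have : Tb * (P / D) = G / D by rewrite -defTP -[LHS]cosetpreK -/(gval U) defU.
  move=> defG; apply/eqP; rewrite eqEsubset sTK /=.
  have tiKP : Kb :&: P / D = 1.
    by rewrite setIC; apply/coprime_TIg/(pnat_coprime (pHall_pgroup sylPb))/pcore_pgroup.
  have -> : Kb = Tb * (Kb :&: P / D).
    by rewrite setIC group_modl // defG; apply/esym/setIidPr/pcore_sub.
  by rewrite tiKP mulg1.
have ltUG : U \proper G by rewrite properEneq neqUG.
have pnU := IHG ltUG sPU.
have nsDU : D <| U by rewrite /normal sDU (subset_trans sUG).
have pU : p.-group U.
  apply: (pnil_pgroup pnU).
  have sOD : 'O_p^'(U) \subset D.
    apply: subset_trans cGD; rewrite subsetI gFsub_trans //=.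
    exact: pnil_p'pcore_cent pnU pD nsDU.
  by rewrite -(coprime_TIg (pnat_coprime pD (pcore_pgroup p^' U))) (setIidPr sOD).
case/eqP: ntT.
have pT : p.-group Tb.
  have : p.-group (U / D) by apply: quotient_pgroup.
  by rewrite cosetpreK; apply: pgroupS; apply: joing_subl.
by rewrite -(coprime_TIg (pnat_coprime pT (pcore_pgroup p^' (G / D)))) (setIidPl sTK).
Qed.

Let r := pdiv #|Kb|.

(** By coprime action [P / D] normalises some Sylow r-subgroup of [Kb], which [irrKb] identifies
    with [Kb]. *)
Let rKb : r.-group Kb.
Proof.
have p'K : p^'.-group Kb := pcore_pgroup _ _.
have nKbP : P / D \subset 'N(Kb) by rewrite (subset_trans (quotientS _ sPG)) ?gFnorm.
have coKP : coprime #|Kb| #|P / D|.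
  by rewrite coprime_sym (pnat_coprime (pHall_pgroup sylPb)).
have solPb := pgroup_sol (pHall_pgroup sylPb).
have [R sylR nRP] := sol_coprime_Sylow_exists r solPb nKbP coKP.
have ntR : R :!=: 1.
  rewrite -rank_gt0 (rank_Sylow sylR) p_rank_gt0 pi_pdiv.
  by rewrite cardG_gt1.
by rewrite -(irrKb (pHall_sub sylR) nRP ntR) (pHall_pgroup sylR).
Qed.

Let abKb : abelian Kb.
Proof.
have [K'1 | ntK'] := eqVneq (Kb^`(1))%g 1; first exact/commG1P.
have nK'P : P / D \subset 'N(Kb^`(1)).
  by rewrite gFnorm_trans // (subset_trans (quotientS _ sPG)) ?gFnorm.
have /proper_neq/eqP[] := sol_der1_proper (pgroup_sol rKb) (subxx _) Kbt.
exact: irrKb (der_sub _ _) nK'P ntK'.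
Qed.

(** The module for the final count; by [cVD] and [cGV] its centraliser in [G] is exactly [D]. *)
Let V := 'Ohm_1('Z(D))%G.

Let chV : V \char D. Proof. exact: char_trans (Ohm_char _ _) (center_char _). Qed.
Let sVZ : V \subset 'Z(D). Proof. exact: Ohm_sub. Qed.
Let sVD : V \subset D. Proof. exact: subset_trans sVZ (center_sub _). Qed.
Let nsVG : V <| G. Proof. exact: char_normal_trans chV nsDG. Qed.

Let abelV : p.-abelem V.
Proof. by rewrite Ohm1_abelem ?center_abelian // (pgroupS (center_sub _)). Qed.

Let cVD : D \subset 'C(V).
Proof. by rewrite centsC (subset_trans sVZ) // subsetIr. Qed.

(** [V] contains ['Ohm_1('Z(P))], as [cGD] puts ['Z(P)] inside [D]. Hence ['C_G(V)] lies in the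
    normaliser of a nontrivial characteristic subgroup of [P] and is p-nilpotent. *)
Let cGV : 'C_G(V) \subset D.
Proof.
have nsCG : 'C_G(V) <| G.
  by rewrite /normal subsetIl normsI ?normG ?norms_cent ?normal_norm.
apply: (normal_pnil_pgroup nsCG).
have sZV : 'Ohm_1('Z(P)) \subset V.
  apply: OhmS; rewrite subsetI (subset_trans _ cGD) /=.
    by rewrite (subset_trans (subsetIr _ _)) ?centS.
  by rewrite subsetI (subset_trans (center_sub P) sPG) (subset_trans (subsetIr _ _)) ?centS.
have chZ : 'Ohm_1('Z(P)) \char P := char_trans (Ohm_char _ _) (center_char _).
have ntZ : 'Ohm_1('Z(P)) != 1 by rewrite Ohm1_eq1 center_nil_eq1 // (pgroup_nil pP).
apply: pnilS (chG sylP chZ ntZ).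
by rewrite setIS // (subset_trans (centS sZV)) // cent_sub.
Qed.

(* Otherwise D contains the Thompson subgroup J(P), which is then normal in G. *)
Let exA : exists2 A : {group gT}, A \in 'E_p^('r_p(P))(P) & ~~ (A \subset D).
Proof.
apply/exists_inP; apply: contraR npG; rewrite negb_exists_in => /forall_inP sED.
pose J := <<\bigcup_(A in 'E_p^('r_p(P))(P)) A>>%G.
have chJ : J \char P := pElem_max_gen_char p _ P.
have ntJ : J :!=: 1.
  have [A EA] := p_rank_witness p P.
  have ntA : A :!=: 1.
    apply: (nt_pnElem EA); rewrite p_rank_gt0 mem_primes p_pr cardG_gt0 /=.
    by have [] := pgroup_pdiv pP ntP.
  apply: contra ntA; rewrite -!subG1; apply: subset_trans.
  by rewrite sub_gen // (bigcup_max A).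
apply: pnilS (chG sylP chJ ntJ).
rewrite subsetI subxx norms_gen //; apply/subsetP=> x Gx; rewrite inE.
rewrite -bigcupJ; apply/bigcupsP=> A EA.
have sAD := negbNE (sED A EA).
rewrite (bigcup_max (A :^ x)%G) // ; case/pnElemP: EA => sAP abA oA.
apply/pnElemP; rewrite abelemJ cardJg; split=> //.
by apply: subset_trans sDP; rewrite -(normsP nDG x Gx) conjSg.
Qed.

(** [X] commutes with [Kb] and [Kb * X = 'C_(G / D)(Kb)], so [X] is normal there and lies in the
    trivial p-core of [G / D]. *)
Let cPbKb : 'C_(P / D)(Kb) = 1.
Proof.
apply/trivgP; rewrite -(trivg_pcore_quotient p G).
pose X := 'C_(P / D)(Kb)%G; pose C := 'C_(G / D)(Kb)%G.
have nsC : C <| G / D by rewrite /normal subsetIl normsI ?normG ?norms_cent ?gFnorm.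
have sKC : Kb \subset C by rewrite subsetI pcore_sub.
have defC : Kb * X = C.
  by rewrite group_modl ?defGb //; apply: abKb.
have sXC : X \subset C by rewrite -defC mulG_subr.
have nsXC : X <| C.
  rewrite /normal sXC -defC mul_subG ?normG // cents_norm // centsC.
  exact: subsetIr.
have pX : p.-group X := pgroupS (subsetIl _ _) (pHall_pgroup sylPb).
apply: subset_trans (pcore_max pX nsXC) _.
by rewrite pcore_max ?pcore_pgroup // gFnormal_trans.
Qed.

(** For [A] of maximal rank outside [D], a copy [B] of [A] modulo [D] normalises a complement [Q] of
    [D] in [K]. The action on [Q] and [V] forces [#|V : 'C_V(A)|] to exceed [#|A : A :&: D|], while
    maximality of the rank of [A] bounds it by that number. *)
Lemma thompson_no_counterexample : False.
Proof.
have [Q sylQ] := Sylow_exists r K.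
have r_pr : prime r by rewrite pdiv_prime // cardG_gt1.
have sQK := pHall_sub sylQ; have sQG := subset_trans sQK sKG.
have nDQ : Q \subset 'N(D) := subset_trans sQG nDG.
have defQb : Q / D = Kb.
  have : r.-Sylow(K / D) (Q / D) by apply: quotient_pHall.
  by move/pHall_id; rewrite /= defKb; apply.
have defK : D * Q = K by have := quotientK nDQ; rewrite defQb => <-.
have p'Q : p^'.-group Q.
  apply: pi_p'group (pHall_pgroup sylQ) _.
  have := pgroupP (pcore_pgroup p^' (G / D)) r r_pr (pdiv_dvd _).
  by rewrite !inE eq_sym.
have tiDQ : D :&: Q = 1 := coprime_TIg (pnat_coprime pD p'Q).
have abQ : abelian Q by rewrite (isog_abelian (quotient_isog nDQ tiDQ)) /= defQb.
have defG : D * 'N_G(Q) = G.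
  rewrite -[RHS](Frattini_arg nsKG sylQ) -defK -mulgA; congr (_ * _).
  by rewrite mulSGid // subsetI sQG normG.
have [A EA nsAD] := exA; have [sAP abelA oA] := pnElemP EA.
pose AD := (A <*> D)%G.
have sADP : AD \subset P by rewrite join_subG sAP.
have nDA := subset_trans sAP nDP.
pose B := 'N_AD(Q)%G.
have sBP : B \subset P by apply: subset_trans sADP; apply: subsetIl.
have sBG := subset_trans sBP sPG.
(* Dedekind's law applied to [D * 'N_G(Q) = G]. *)
have defDB : D * B = AD.
  have -> : gval B = 'N_G(Q) :&: AD.
    by rewrite setIAC (setIidPr (subset_trans sADP sPG)).
  by rewrite group_modl ?joing_subr // defG; apply/setIidPr/(subset_trans sADP).
pose E := (D :&: B)%G.
have defBD : B / D = A / D.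
  by rewrite -(quotientMidl D B) defDB quotientYidr.
have isoBE : B / E \isog B / D := second_isog (subset_trans sBP nDP).
have nsVE : E \subset D := subsetIl _ _.
have cEQ : E \subset 'C(Q).
  apply/commG1P/trivgP; rewrite -tiDQ subsetI commg_subr.
  rewrite (subset_trans (commSg Q nsVE)) ?commg_subl //=.
  exact: subset_trans (subsetIr _ _) (subsetIr _ _).
have cBQ : 'C_B(Q) \subset E.
  rewrite subsetI subsetIl andbT.
  rewrite -quotient_sub1; last by rewrite (subset_trans _ nDP) // subIset ?sBP.
  rewrite -cPbKb subsetI -defQb; apply/andP; split.
    by rewrite quotientS // subIset ?sBP.
  exact/quotient_cents/subsetIr.
(* [A] and [B] generate the same group with [D], which centralises [V]. *)
have cBV : 'C_V(B) = 'C_V(A).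
  have cDV : V :&: 'C(D) = V by apply/setIidPl; rewrite centsC.
  rewrite -[in LHS]cDV -[in RHS]cDV -!setIA -centM defDB centY.
  by congr (_ :&: _); apply: setIC.
have lt : #|B : E| < #|V : 'C_V(B)|.
  apply: (@pgroup_lt_index_cent p gT B Q V E) => //.
  - exact: subsetIr.
  - by rewrite (isog_abelem isoBE) /= defBD quotient_abelem.
  - exact: abelem_abelian abelV.
  - exact: abelem_pgroup abelV.
  - exact: pgroupS pD.
  - by rewrite normsI ?normG // (subset_trans sBG).
  - exact: subsetIr.
  - by rewrite (subset_trans sBG) ?normal_norm.
  - by rewrite (subset_trans sQG) ?normal_norm.
  - exact: subset_trans cVD.
  - apply/trivgP; rewrite -tiDQ subsetI subsetIl andbT.
    by apply: subset_trans cGV; rewrite setSI.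
  apply: contra nsAD => sBE; rewrite -(quotient_sub1 nDA) -defBD quotient_sub1.
    exact: subset_trans sBE nsVE.
  exact: subset_trans sBP nDP.
have iBE : #|B : E| = #|A : A :&: D|.
  rewrite -card_quotient; last by rewrite normsI ?normG // (subset_trans sBG).
  by rewrite (card_isog isoBE) /= defBD card_quotient // indexgI.
have cVAD : A :&: D \subset 'C(V) by rewrite subIset ?cVD ?orbT.
pose W := (V <*> (A :&: D))%G.
(* W is elementary abelian and A has maximal rank, so #|W| <= #|A|; this
   bounds #|V : 'C_V(A)| against [lt]. *)
have oW : #|W| <= #|A|.
  have EW : W \in 'E_p(P).
    rewrite !inE /= join_subG (subset_trans sVD) // subIset ?sAP //=.
    rewrite (cprod_abelem p (cprodEY cVAD)) abelV.
    exact: abelemS (subsetIl _ _) abelA.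
  have pW : p.-group W by case/pElemP: EW => _ /abelem_pgroup.
  rewrite (card_pgroup pW) (card_pnElem EA) leq_exp2l ?prime_gt1 //.
  exact: logn_le_p_rank EW.
have : #|V : V :&: A| <= #|A : A :&: D|.
  have tiVA : V :&: (A :&: D) = V :&: A.
    by rewrite setIC -setIA (setIidPr sVD) setIC.
  have := mul_cardG V (A :&: D).
  rewrite -(norm_joinEr (cents_norm cVAD)) -/(gval W) tiVA => oVAD.
  have : #|W| * #|V :&: A| <= #|A| * #|V :&: A| by rewrite leq_mul2r oW orbT.
  rewrite -oVAD -{1}(Lagrange (subsetIl V A)) -(Lagrange (subsetIl A D)).
  rewrite mulnAC [X in _ <= X]mulnAC [X in _ <= X * _]mulnC.
  by rewrite leq_pmul2l // muln_gt0 !cardG_gt0.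
rewrite leqNgt -iBE => /negP; apply; apply: leq_trans lt _.
rewrite cBV dvdn_leq ?indexg_gt0 // indexgS // setIS //.
exact: abelem_abelian abelA.
Qed.

End MinimalCounterexample.

(** Induction on the order: a nontrivial p'-core is factored out; otherwise proper subgroups
    containing P and the quotient by the nontrivial p-core are p-nilpotent, as the minimal
    counterexample requires. *)
Theorem Thompson_pnil (p : nat) (gT : finGroupType) (G : {group gT}) :
  prime p -> odd p -> char_pnil p G -> pnil p G.
Proof.
move=> p_pr p_odd; have [n] := ubnP #|G|.
elim: n => // n IHn in gT G * => ltGn chG.
have IHq (N : {group gT}) : N <| G -> N :!=: 1 ->
    char_pnil p (G / N) -> pnil p (G / N).
  move=> nsNG ntN; apply: IHn; apply: (@leq_trans #|G|) => //.
  by rewrite ltn_quotient ?normal_sub.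
have [Op'1 | ntOp'] := eqVneq 'O_p^'(G) 1; last first.
  apply: (pnil_pgroup (IHq _ (pcore_normal _ _) ntOp' _)).
    exact: char_pnil_p'quotient (pcore_normal _ _) (pcore_pgroup _ _) chG.
  exact: trivg_pcore_quotient.
apply: contraT => npG.
have IHG (U : {group gT}) : U \proper G -> char_pnil p U -> pnil p U.
  by move=> ltUG; apply: IHn; apply: leq_trans (proper_card ltUG) _.
have [P sylP] := Sylow_exists p G.
case: (thompson_no_counterexample p_pr p_odd sylP chG _ npG Op'1) => [U ltUG sPU|].
  exact: IHG (char_pnilS sylP sPU (proper_sub ltUG) chG).
apply: IHq (pcore_normal _ _) (char_pnil_pcore_neq1 chG IHG npG) _.
exact: char_pnil_quotient_pcore chG IHG.
Qed.

(** * Groups whose maximal subgroups are nilpotent or normal *)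

Definition maximal_nil_or_normal (gT : finGroupType) (G : {group gT}) :=
  forall M : {group gT}, maximal M G -> nilpotent M \/ M <| G.

Lemma maximal_nil_or_normal_quotient (gT : finGroupType) (G N : {group gT}) :
  N <| G -> maximal_nil_or_normal G -> maximal_nil_or_normal (G / N).
Proof.
move=> nsNG maxG Mb maxMb.
have [M defMb sNM sMG] := inv_quotientS nsNG (proper_sub (maxgroupp maxMb)).
have nsNM : N <| M by rewrite /normal sNM (subset_trans sMG) ?normal_norm.
have maxM : maximal M G.
  by rewrite -(quotient_maximal nsNM nsNG) -defMb.
have [nilM | nsMG] := maxG M maxM; [left | right]; rewrite defMb.
  exact: quotient_nil.
exact: quotient_normal.
Qed.

Lemma maximal_nil_or_normal_solvable (gT : finGroupType) (G : {group gT}) :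
  maximal_nil_or_normal G -> solvable G.
Proof.
have [n] := ubnP #|G|.
elim: n => // n IHn in gT G * => ltGn maxG.
have [-> | ntG] := eqVneq (gval G) 1; first exact: solvable1.
have [N minN sNG] := minnormal_exists ntG (normG G).
have [/andP[ntN nNG] minN'] := mingroupP minN.
have nsNG : N <| G by apply/andP.
have solGN : solvable (G / N).
  apply: (IHn); last exact: maximal_nil_or_normal_quotient.
  by apply: (@leq_trans #|G|) => //; rewrite ltn_quotient.
rewrite (series_sol nsNG) solGN andbT.
apply: contraT => nsolN.
have irrN (H : {group gT}) : H <| G -> H \subset N -> H :!=: 1 -> H :=: N.
  by move=> nsHG sHN ntH; apply: minN' => //; rewrite ntH normal_norm.
have [p p_pr [p_odd pN]] : exists2 p, prime p & odd p /\ p %| #|N|.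
  have n2N : (#|N|`_2^' != 1)%N.
    by rewrite partG_eq1 pgroupNK; apply: contra nsolN; apply: pgroup_sol.
  have p_pr : prime (pdiv #|N|`_2^')
    by rewrite pdiv_prime // ltn_neqAle eq_sym n2N part_gt0.
  have pN := pdiv_dvd (#|N|`_2^')%N.
  exists (pdiv #|N|`_2^') => //; split; last exact: dvdn_trans pN (dvdn_part _ _).
  have [p2 | //] := even_prime p_pr.
  by have := pnat_dvd pN (part_pnat _ _); rewrite pnatE // p2.
have pnN : pnil p N.
  apply: Thompson_pnil => // P D sylP chD ntD.
  have sDN : D \subset N := subset_trans (char_sub chD) (pHall_sub sylP).
  have pD : p.-group D := pgroupS (char_sub chD) (pHall_pgroup sylP).
  have sNN : 'N_G(P) \subset 'N_G(D) by rewrite setIS // char_norms.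
  have defG : N * 'N_G(P) = G := Frattini_arg nsNG sylP.
  case: (maximal_exists (subsetIl G 'N(D))) => [defN | [M maxM sNM]].
    (* If [D] is normal in [G], minimality makes it [N], which is then a p-group. *)
    case/negP: nsolN; rewrite -(irrN D) ?(pgroup_sol pD) //.
    by rewrite /normal (subset_trans sDN sNG) -{1}defN subsetIr.
  have [nilM | nsMG] := maxG M maxM.
    apply: nilpotent_pnil; apply: nilpotentS nilM.
    by apply: subset_trans sNM; apply: setSI.
  (* [M :&: N] is normal in [G] and contains [D], so it is [N]; then [M] contains both factors of
     [G = N * 'N_G(P)]. *)
  have sNM' : N \subset M.
    have sDM : D \subset M.
      by apply: subset_trans sNM; rewrite subsetI normG (subset_trans sDN).
    have <- : M :&: N = N.
      apply: irrN; [exact: normalI | exact: subsetIr |].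
      by apply: contra ntD; rewrite -!subG1; apply: subset_trans; rewrite subsetI sDM.
    exact: subsetIl.
  have /maxgroupp/andP[_ /negP[]] := maxM.
  by rewrite -defG mul_subG // (subset_trans sNN).
have [Op'1 | ntOp'] := eqVneq 'O_p^'(N) 1.
  by case/negP: nsolN; apply: pgroup_sol (pnil_pgroup pnN Op'1).
have defO : 'O_p^'(N) = N.
  by apply: irrN; rewrite ?pcore_sub // gFnormal_trans.
have := pgroupP (pcore_pgroup p^' N) p p_pr.
by rewrite /= defO !inE eqxx => /(_ pN).
Qed.

Lemma solvable_pnil_or_Sylow_normal (q : nat) (gT : finGroupType) (G Q : {group gT}) :
    prime q -> solvable G -> maximal_nil_or_normal G -> q.-Sylow(G) Q ->
  pnil q G \/ Q <| G.
Proof.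
move=> q_pr; have [n] := ubnP #|G|.
elim: n => // n IHn in gT G Q * => ltGn solG maxG sylQ.
have [sQG qQ _] := and3P sylQ.
have [nsQG | nnsQG] := boolP (Q <| G); [by right | left].
have IHq (N : {group gT}) : N <| G -> N :!=: 1 ->
    pnil q (G / N) \/ Q / N <| G / N.
  move=> nsNG ntN; have [sNG nNG] := andP nsNG.
  apply: IHn; first by apply: (@leq_trans #|G|) => //; rewrite ltn_quotient.
  - exact: quotient_sol.
  - exact: maximal_nil_or_normal_quotient.
  exact: quotient_pHall (subset_trans sQG nNG) sylQ.
have [Oq'1 | ntOq'] := eqVneq 'O_q^'(G) 1; last first.
  apply: pnil_pgroup (trivg_pcore_quotient _ _).
  have nsRG := pcore_normal q^' G; have [sRG nRG] := andP nsRG.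
  have [// | nsQR] := IHq _ nsRG ntOq'.
  have nRQ := subset_trans sQG nRG.
  (* By the Frattini argument a normal maximal subgroup cannot contain ['N_G(Q)]. *)
  have nilN : nilpotent 'N_G(Q).
    case: (maximal_exists (subsetIl G 'N(Q))) => [defN | [M maxM sNM]].
      by case/negP: nnsQG; rewrite /normal sQG -{1}defN subsetIr.
    have [nilM | nsMG] := maxG M maxM; first exact: nilpotentS sNM nilM.
    have sQM : Q \subset M.
      by apply: subset_trans sNM; rewrite subsetI sQG normG.
    have sylQM := pHall_subl sQM (normal_sub nsMG) sylQ.
    have /maxgroupp/andP[_ /negP[]] := maxM.
    by rewrite -(Frattini_arg nsMG sylQM) mul_subG.
  have nsRQR : 'O_q^'(G) <| Q <*> 'O_q^'(G).
    by rewrite /normal joing_subr join_subG nRQ normG.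
  have nsQRG : Q <*> 'O_q^'(G) <| G.
    by move: nsQR; rewrite -(quotientYidr nRQ) -cosetpre_normal !quotientGK.
  have sylQR : q.-Sylow(Q <*> 'O_q^'(G)) Q.
    by apply: pHall_subl sylQ; rewrite ?joing_subl ?normal_sub.
  (* The Frattini argument for [Q] in [Q <*> 'O_q^'(G)] shows that ['N_G(Q)] covers
     [G / 'O_q^'(G)]. *)
  apply: pnilS (nilpotent_pnil q (quotient_nil 'O_q^'(G) nilN)).
  have : (Q <*> 'O_q^'(G)) * 'N_G(Q) / 'O_q^'(G) \subset 'N_G(Q) / 'O_q^'(G).
    rewrite quotientMl; last by rewrite join_subG nRQ normG.
    by rewrite quotientYidr // mul_subG // quotientS // subsetI sQG normG.
  by rewrite (Frattini_arg nsQRG sylQR).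
have nsDG := pcore_normal q G; have [sDG nDG] := andP nsDG.
have qD : q.-group 'O_q(G) := pcore_pgroup q G.
have sDQ : 'O_q(G) \subset Q := pcore_sub_Hall sylQ.
have nDQ := subset_trans sQG nDG.
have ntD : 'O_q(G) != 1.
  apply: contra nnsQG => D1.
  have : 'F(G) == 1 by rewrite (Fitting_eq_pcore Oq'1).
  by rewrite trivg_Fitting // => /eqP G1; move: sQG; rewrite G1 => /trivgP ->.
have nnsQD : ~~ (Q / 'O_q(G) <| G / 'O_q(G)).
  by apply: contra nnsQG; rewrite -cosetpre_normal !quotientGK // /normal sDQ.
have [pnGD | nsQD] := IHq _ nsDG ntD; last by case/negP: nnsQD.
pose K := (coset 'O_q(G) @*^-1 'O_q^'(G / 'O_q(G)))%G.
have defKb : K / 'O_q(G) = 'O_q^'(G / 'O_q(G)) := cosetpreK _.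
have sDK : 'O_q(G) \subset K := sub_cosetpre _.
have nsKG : K <| G by rewrite -(quotientGK nsDG) cosetpre_normal pcore_normal.
have sKG := normal_sub nsKG.
have solK := solvableS sKG solG.
have nsDK : 'O_q(G) <| K by rewrite /normal sDK (subset_trans sKG).
have hallD : q.-Hall(K) 'O_q(G).
  rewrite /pHall sDK qD -card_quotient ?normal_norm // defKb.
  exact: pcore_pgroup.
have [T hallT] := Hall_exists q^' solK.
have defK : 'O_q(G) * T = K.
  apply/eqP; rewrite eqEcard mul_subG ?(pHall_sub hallT) //.
  rewrite (coprime_cardMg (pnat_coprime qD (pHall_pgroup hallT))).
  by rewrite (card_Hall hallD) (card_Hall hallT) partnC ?leqnn /=.
have defG : 'O_q(G) * 'N_G(T) = G.
  rewrite -[RHS](Hall_Frattini_arg solK nsKG hallT) -defK -mulgA; congr (_ * _).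
  by rewrite mulSGid // subsetI normG (subset_trans (pHall_sub hallT)).
case: (maximal_exists (subsetIl G 'N(T))) => [defN | [H maxH sNH]].
  (* A normal [T] lies in the trivial q'-core, which makes [G] a q-group. *)
  have sTG := subset_trans (pHall_sub hallT) sKG.
  have nsTG : T <| G by rewrite /normal sTG -{1}defN subsetIr.
  have T1 : T :=: 1.
    by apply/trivgP; rewrite -Oq'1 pcore_max ?(pHall_pgroup hallT).
  apply: pgroup_pnil; rewrite -(pquotient_pgroup qD nDG).
  apply: pnil_pgroup pnGD _.
  by rewrite -defKb -defK T1 mulg1 trivg_quotient.
have sNG := subsetIl G 'N(T).
have sTN : T \subset 'N_G(T).
  by rewrite subsetI normG (subset_trans (pHall_sub hallT)).
have [nilH | nsHG] := maxG H maxH.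
  (* [G / 'O_q(G)] is now an image of the nilpotent group ['N_G(T)]. *)
  case/negP: nnsQD.
  have nilGD : nilpotent (G / 'O_q(G)).
    have : nilpotent ('O_q(G) * 'N_G(T) / 'O_q(G)).
      by rewrite quotientMidl; apply: quotient_nil; apply: nilpotentS sNH nilH.
    by rewrite defG.
  by rewrite (nilpotent_Hall_pcore nilGD (quotient_pHall nDQ sylQ)) pcore_normal.
(* The Frattini argument for [T] in the normal subgroup [H :&: K] puts [G] inside [H]. *)
have hallTH : q^'.-Hall(H :&: K) T.
  apply: (pHall_subl _ (subsetIr _ _) hallT).
  by rewrite subsetI (subset_trans sTN sNH) (pHall_sub hallT).
have /maxgroupp/andP[_ /negP[]] := maxH.
rewrite -(Hall_Frattini_arg _ (normalI nsHG nsKG) hallTH).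
  by rewrite mul_subG // subsetIl.
exact: solvableS (subsetIr _ _) solK.
Qed.

Theorem theorem1p8 (gT : finGroupType) (G : {group gT}) :
  (forall M : {group gT}, maximal M G -> nilpotent M \/ M <| G) ->
  forall q : nat, prime q -> q %| #|G| ->
  q_nilpotent q G \/ q_closed q G.
Proof.
move=> maxG q q_pr _; have [Q sylQ] := Sylow_exists q G.
have solG := maximal_nil_or_normal_solvable maxG.
have [pnG | nsQG] := solvable_pnil_or_Sylow_normal q_pr solG maxG sylQ.
  left; exists 'O_q^'(G)%G; split; first exact: pcore_normal.
    rewrite coprime_sym; exact: pnat_coprime (pnat_id q_pr) (pcore_pgroup _ _).
  have qi : q.-nat #|G : 'O_q^'(G)| by rewrite -card_quotient ?gFnorm.
  by have [k ->] := p_natP qi; exists k.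
by right; exists Q; rewrite // inE.
Qed.
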